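(* Let $\{\mathbf{m}^{n},\tilde{\mathbf{m}}^{n},\hat{\mathbf{m}}^{n}\}$, together with $R^n,\xi^n$, be the solution of the order-$l$ IMEX-GSAV scheme described in the context. Given $R^n>0$, we have $\xi^{n+1}>0$ and $$0<R^{n+1}<R^n,\qquad \forall\, n\le T/\Delta t .$$ In addition, there exists a constant $M_T$ independent of $\Delta t$ such that $$\|\nabla\hat{\mathbf{m}}^{n+1}\|+\sum_{k=0}^{n}\Delta t\,\gamma\,\xi^{k+1}\,\|B_l(\mathbf{m}^k)\times\Delta\tilde{\mathbf{m}}^{k+1}\|^2\le M_T,\qquad \forall\, n\le T/\Delta t,\quad n=l-1,\dots,N-1 .$$
   Context: $\Omega\subset\mathbb{R}^d$, $d\in\{1,2,3\}$, is an open bounded domain; homogeneous Neumann or periodic boundary conditions are imposed. $\|\cdot\|$ is the $L^2(\Omega)$ norm, $|\cdot|$ the Euclidean norm, and the fields take values in $\mathbb{R}^3$. The scheme approximates the Landau-Lifshitz equation $\partial_t\mathbf{m}=-\beta\,\mathbf{m}\times\Delta\mathbf{m}+\gamma\Delta\mathbf{m}+\gamma|\nabla\mathbf{m}|^2\mathbf{m}$ on $\Omega\times(0,T]$ with $\mathbf{m}(\cdot,0)=\mathbf{m}_0$, $|\mathbf{m}_0|=1$, where $\gamma>0$ is the damping parameter and $\beta$ is the (real) exchange parameter. Put $\Delta t=T/N$, $t^n=n\Delta t$, $E(\mathbf{m})=\frac12\|\nabla\mathbf{m}\|^2$. $K_0>0$ is a constant, $S\ge0$ a stabilization parameter, $w$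 a positive integer, and $l\ge1$ the order of the scheme. $D_l$ denotes the BDF-$l$ formula and $B_l$ the $l$-th order Adams-Bashforth extrapolation operator: $D_l u^{n+1}=\frac1{\Delta t}\sum_{j=1}^{l}\frac1j\nabla_-^{\,j}u^{n+1}$, where $\nabla_-u^{n+1}=u^{n+1}-u^n$, and $B_l(u^n)=\sum_{i=1}^{l}(-1)^{i-1}\binom{l}{i}u^{n+1-i}$. For example $D_1u^{n+1}=\frac{u^{n+1}-u^n}{\Delta t}$, $D_2u^{n+1}=\frac{3u^{n+1}-4u^n+u^{n-1}}{2\Delta t}$, $D_3u^{n+1}=\frac{11u^{n+1}-18u^n+9u^{n-1}-2u^{n-2}}{6\Delta t}$, $B_1(u^n)=u^n$, $B_2(u^n)=2u^n-u^{n-1}$, $B_3(u^n)=3u^n-3u^{n-1}+u^{n-2}$. Scheme of order $l$: the scalar auxiliary variable starts from $R^0=E(\mathbf{m}_0)+K_0$. Assuming $\mathbf{m}^j,\tilde{\mathbf{m}}^j$ with $j=n,n-1,\dots,n-l+1$ are given: (1) solve $\tilde{\mathbf{m}}^{n+1}$ from $$D_l\tilde{\mathbf{m}}^{n+1}=\gamma\Delta\tilde{\mathbf{m}}^{n+1}+S\Delta(\tilde{\mathbf{m}}^{n+1}-B_l(\mathbf{m}^n))+\gamma|\nabla B_l(\mathbf{m}^n)|^2B_l(\mathbf{m}^n)-\beta B_l(\mathbf{m}^n)\times\Delta B_l(\tilde{\mathbf{m}}^n);$$ (2) compute real numbers $R^{n+1},\xi^{n+1}$ from $$\frac{R^{n+1}-R^n}{\Delta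 t}=-\gamma\,\xi^{n+1}\|B_l(\mathbf{m}^n)\times\Delta\tilde{\mathbf{m}}^{n+1}\|^2,\qquad \xi^{n+1}=\frac{R^{n+1}}{E(\tilde{\mathbf{m}}^{n+1})+K_0};$$ (3) update $\mathbf{m}^{n+1}=\hat{\mathbf{m}}^{n+1}/|\hat{\mathbf{m}}^{n+1}|$ with $\hat{\mathbf{m}}^{n+1}=\eta_l^{n+1}\tilde{\mathbf{m}}^{n+1}+(\eta_l^{n+1}-1)^w$ (the scalar $(\eta_l^{n+1}-1)^w$ being added to each component), where $\eta_1^{n+1}=1-(1-\xi^{n+1})^2$ and $\eta_l^{n+1}=1-(1-\xi^{n+1})^l$ for $l\ge2$.
   Formalization: The strict inequality R^{n+1}<R^n is claimed only when ‖B_l(m^n)×Δm̃^{n+1}‖>0, and R^{n+1}≤R^n in general: for a constant unit field m_0 the scheme gives R^{n+1}=R^n, so the strict claim fails as stated. *)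

(* Defs.v *)
From HB Require Import structures.
From mathcomp Require Import all_boot all_order all_algebra.
From mathcomp Require Import all_classical all_reals all_analysis.

Set Implicit Arguments.
Unset Strict Implicit.
Unset Printing Implicit Defensive.

Import Order.TTheory GRing.Theory Num.Theory.
Import numFieldNormedType.Exports.

Local Open Scope classical_set_scope.
Local Open Scope ring_scope.

Section Euclidean.
Context {R : realType}.

(* The library's norm `|A| on matrices is the maximum norm. *)
Definition enorm (p q : nat) (A : 'M[R]_(p, q)) : R :=
  Num.sqrt (\sum_i \sum_j A i j ^+ 2).

(* Indices of 'I_3 are added modulo 3. *)
Definition cross (u v : 'rV[R]_3) : 'rV[R]_3 :=
  \row_(k < 3) (u 0 (k + 1) * v 0 (k + 2%:R) - u 0 (k + 2%:R) * v 0 (k + 1)).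

Definition basis_vec (d : nat) (i : 'I_d) : 'rV[R]_d := delta_mx 0 i.

End Euclidean.

Section Lebesgue.
Context {R : realType}.

Local Notation RT := (measurableTypeR R).

Definition tcons (n : nat) (p : RT * n.-tuple RT) : n.+1.-tuple RT :=
  [tuple of p.1 :: p.2].

(* Lebesgue measure on R^n, as an iterated product; R^0 carries the unit mass. *)
Fixpoint lebesgue_tuple (n : nat) : set (n.-tuple RT) -> \bar R :=
  match n with
  | 0 => \d_([tuple] : 0.-tuple RT)
  | n'.+1 => pushforward
      (@lebesgue_measure R \x @lebesgue_tuple n')%E (@tcons n')
  end.

Lemma measurable_tcons n : measurable_fun setT (@tcons n).
Proof. exact: measurable_cons. Qed.

Section lebesgue_step.
Variables (n : nat) (mu : {sigma_finite_measure set (n.-tuple RT) -> \bar R}).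
Let leb : {sigma_finite_measure set RT -> \bar R} := @lebesgue_measure R.
Let nu : set (n.+1.-tuple RT) -> \bar R := pushforward (leb \x mu)%E (@tcons n).

Let nu_sigma_finite : sigma_finite setT nu.
Proof.
have /sigma_finiteP[F [TF ndF Foo]] := sigma_finiteT leb.
have /sigma_finiteP[G [TG ndG Goo]] := sigma_finiteT mu.
pose uncons (t : n.+1.-tuple RT) : RT * n.-tuple RT :=
  (thead t, [tuple of behead t]).
have muncons : measurable_fun setT uncons.
  apply/measurable_fun_pairP; split; first exact: measurable_tnth.
  exact: measurable_behead.
have tconsK : cancel (@tcons n) uncons.
  by move=> [x t]; congr pair; exact/val_inj.
exists (fun i => uncons @^-1` (F i `*` G i)).
  rewrite -preimage_bigcup; apply/esym/seteqP; split=> // t _.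
  have [i _ Fi] : (\bigcup_i F i) (uncons t).1 by rewrite -TF.
  have [j _ Gj] : (\bigcup_i G i) (uncons t).2 by rewrite -TG.
  exists (maxn i j) => //; split.
    by move: Fi; exact/subsetPset/ndF/leq_maxl.
  by move: Gj; exact/subsetPset/ndG/leq_maxr.
move=> k; have [? ?] := Foo k; have [? ?] := Goo k; split.
  by rewrite -[X in measurable X]setTI; apply: muncons => //; exact: measurableX.
rewrite /nu /pushforward -comp_preimage (_ : _ \o _ = id); last first.
  by apply/funext => p /=; rewrite tconsK.
by rewrite preimage_id product_measure1E// lte_mul_pinfty// ge0_fin_numE.
Qed.

Let nu0 : nu set0 = 0%E.
Proof. by rewrite /nu /pushforward preimage_set0 measure0. Qed.

Let nu_ge0 A : (0 <= nu A)%E.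
Proof. by rewrite /nu /pushforward measure_ge0. Qed.

Let nu_sigma_additive : semi_sigma_additive nu.
Proof.
move=> F mF tF mUF; rewrite /nu /pushforward preimage_bigcup.
apply: measure_semi_sigma_additive.
- by move=> i; rewrite -[X in measurable X]setTI; exact: measurable_tcons.
- apply/trivIsetP => /= i j _ _ ij; rewrite -preimage_setI.
  by move/trivIsetP : tF => /(_ _ _ _ _ ij) ->//; rewrite preimage_set0.
- by rewrite -preimage_bigcup -[X in measurable X]setTI; exact: measurable_tcons.
Qed.

Definition lebesgue_step := nu.

HB.instance Definition _ := isMeasure.Build _ _ _ lebesgue_step
  nu0 nu_ge0 nu_sigma_additive.
HB.instance Definition _ := Measure_isSigmaFinite.Build _ _ _ lebesgue_step
  nu_sigma_finite.

End lebesgue_step.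

Lemma lebesgue_tuple_spec n :
  exists mu : {sigma_finite_measure set (n.-tuple RT) -> \bar R},
    @lebesgue_tuple n = mu.
Proof.
elim: n => [|n [mu IH]].
  by exists (\d_([tuple] : 0.-tuple RT) : {finite_measure set (0.-tuple RT) -> \bar R}).
by exists (lebesgue_step mu); rewrite /= IH.
Qed.

Section measure.
Variable n : nat.

Let mu0 : @lebesgue_tuple n set0 = 0%E.
Proof. by have [mu ->] := lebesgue_tuple_spec n. Qed.

Let mu_ge0 A : (0 <= @lebesgue_tuple n A)%E.
Proof. by have [mu ->] := lebesgue_tuple_spec n. Qed.

Let mu_sigma_additive : semi_sigma_additive (@lebesgue_tuple n).
Proof.
have [mu ->] := lebesgue_tuple_spec n; exact: measure_semi_sigma_additive.
Qed.

Let mu_sigma_finite : sigma_finite setT (@lebesgue_tuple n).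
Proof. have [mu ->] := lebesgue_tuple_spec n; exact: sigma_finiteT. Qed.

HB.instance Definition _ := isMeasure.Build _ _ _ (@lebesgue_tuple n)
  mu0 mu_ge0 mu_sigma_additive.
HB.instance Definition _ := Measure_isSigmaFinite.Build _ _ _
  (@lebesgue_tuple n) mu_sigma_finite.

End measure.

Lemma lebesgue_tuple_box n (A : 'I_n -> set RT) :
  (forall i, measurable (A i)) ->
  @lebesgue_tuple n [set t | forall i, A i (tnth t i)]
    = (\prod_(i < n) @lebesgue_measure R (A i))%E.
Proof.
elim: n A => [|n IH] A mA.
  by rewrite big_ord0 /= diracE mem_set// => -[].
rewrite big_ord_recl -IH; last by [].
have mB : measurable [set t : n.-tuple RT | forall i, A (lift ord0 i) (tnth t i)].
  rewrite (_ : mkset _ =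
      \bigcap_(i in setT) ((@tnth _ _ ^~ i) @^-1` A (lift ord0 i))); last first.
    by apply/seteqP; split => [t Ht i _|t Ht i]; [exact: Ht|exact: (Ht i I)].
  apply: fin_bigcap_measurable => // i _.
  by rewrite -[X in measurable X]setTI; exact: measurable_tnth.
rewrite [LHS]/= /pushforward.
rewrite (_ : @tcons n @^-1` _ =
    A ord0 `*` [set t | forall i, A (lift ord0 i) (tnth t i)]).
  exact: product_measure1E.
apply/seteqP; split => [[x t] /= H|[x t] /= [H1 H2] i].
  by split; [have := H ord0|move=> i; have := H (lift ord0 i); rewrite tnthS].
have [j ->|->//] := unliftP ord0 i.
by rewrite tnthS; exact: H2.
Qed.

Definition row_of_tuple (d : nat) (t : d.-tuple RT) : 'rV[R]_d :=
  \row_i tnth t i.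

Section L2.
Context {d p q : nat}.
Variables (Omega : set 'rV[R]_d) (f : 'rV[R]_d -> 'M[R]_(p, q)).

(* Measurability is automatic for the functions used below, which are
   continuous on the open set Omega. *)
Definition square_integrable : Prop :=
  (\int[@lebesgue_tuple d]_(t in @row_of_tuple d @^-1` Omega)
      (enorm (f (row_of_tuple t)) ^+ 2)%:E < +oo)%E.

Definition L2norm : R :=
  Num.sqrt (\int[@lebesgue_tuple d]_(t in @row_of_tuple d @^-1` Omega)
      (enorm (f (row_of_tuple t)) ^+ 2)).

End L2.
End Lebesgue.

Section Calculus.
Context {R : realType} {d : nat}.

Local Notation point := 'rV[R]_d.
Local Notation field := ('rV[R]_d -> 'rV[R]_3).
Local Notation e := (@basis_vec R d).

(* Row i of the Jacobian matrix is the partial derivative along e_i. *)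
Definition grad (u : field) : point -> 'M[R]_(d, 3) := fun x => 'J u x.

Definition laplacian (u : field) : field :=
  fun x => \sum_(i < d) 'D_(e i) ('D_(e i) u) x.

Definition crossf (u v : field) : field := fun x => cross (u x) (v x).

Definition C2_on (A : set point) (u : field) : Prop :=
  forall x, A x ->
    [/\ differentiable u x,
        forall i, differentiable ('D_(e i) u) x &
        forall i j, {for x, continuous ('D_(e i) ('D_(e j) u))}].

(* nu is the outward unit normal at the boundary point x, near which Omega is
   the sublevel set {phi < 0} of a C^1 function phi with non-zero gradient. *)
Definition outward_normal (Omega : set point) (x nu : point) : Prop :=
  enorm nu = 1 /\
  exists (phi : point -> R) (c : R),
    [/\ 0 < c, phi x = 0,
        forall v, 'D_v phi x = c * \sum_(i < d) nu 0 i * v 0 i,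
        \forall y \near x, differentiable phi y /\
          forall i, {for y, continuous ('D_(e i) phi)} &
        \forall y \near x, Omega y <-> phi y < 0].

(* Omega carries no smoothness assumption: the normal derivative is required to
   vanish at every boundary point that has an outward normal. *)
Definition neumann (Omega : set point) (u : field) : Prop :=
  forall x nu, outward_normal Omega x nu ->
    'D_nu u y @[y --> within Omega (nbhs x)] --> (0 : 'rV[R]_3).

Inductive boundary_condition : Type :=
| Neumann
| Periodic of point.

(* In the periodic case Omega is an open box with side lengths P. *)
Definition bc_domain (bc : boundary_condition) (Omega : set point) : Prop :=
  match bc with
  | Neumann => True
  | Periodic P => exists a : point,
      Omega = [set x | forall i, a 0 i < x 0 i < a 0 i + P 0 i]
  end.

Definition bc_holds (bc : boundary_condition) (Omega : set point) (u : field) :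
    Prop :=
  match bc with
  | Neumann => C2_on Omega u /\ neumann Omega u
  | Periodic P => C2_on setT u /\ forall x i, u (x + P 0 i *: e i) = u x
  end.

Definition admissible (bc : boundary_condition) (Omega : set point) (u : field) :
    Prop :=
  bc_holds bc Omega u /\ square_integrable Omega (grad u).

Definition energy (Omega : set point) (u : field) : R :=
  2^-1 * L2norm Omega (grad u) ^+ 2.

End Calculus.
Arguments boundary_condition : clear implicits.
Arguments Neumann {R d}.

Section TimeStepping.
Context {R : realType} {V : lmodType R}.

Definition backward_diff (u : int -> V) : int -> V := fun n => u n - u (n - 1).

Definition bdf (dt : R) (l : nat) (u : int -> V) (n : int) : V :=
  dt^-1 *: \sum_(1 <= j < l.+1) (j%:R : R)^-1 *: iter j backward_diff u n.

Definition extrapolation (l : nat) (u : int -> V) (n : int) : V :=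
  \sum_(1 <= i < l.+1)
     ((-1) ^+ i.-1 * ('C(l, i))%:R : R) *: u (n + 1 - i%:Z).

End TimeStepping.

Definition eta_coef (R : realType) (l : nat) (xi : R) : R :=
  if l == 1%N then 1 - (1 - xi) ^+ 2 else 1 - (1 - xi) ^+ l.

Section Scheme.
Context {R : realType} {d : nat}.

Local Notation field := ('rV[R]_d -> 'rV[R]_3).

(* Parameters: domain, boundary condition, damping, exchange, stabilization,
   energy shift, order, exponent, number of steps, step size, initial field. *)
Variables (Omega : set 'rV[R]_d) (bc : boundary_condition R d).
Variables (gamma beta S K0 : R) (l w N : nat) (dt : R) (m0 : field).

(* m, mt, mh stand for m, \tilde m, \hat m; r is the scalar variable R^n. *)
Variables (m mt : int -> field) (mh : nat -> field) (r xi : nat -> R).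

Local Notation B := (extrapolation l).

Definition semi_implicit_step (n : nat) : Prop :=
  forall x, Omega x ->
    bdf dt l mt n.+1%:Z x =
      gamma *: laplacian (mt n.+1%:Z) x
      + S *: laplacian (mt n.+1%:Z - B m n%:Z) x
      + (gamma * enorm (grad (B m n%:Z) x) ^+ 2) *: B m n%:Z x
      - beta *: cross (B m n%:Z x) (laplacian (B mt n%:Z) x).

Definition dissipation_field (n : nat) : field :=
  crossf (B m n%:Z) (laplacian (mt n.+1%:Z)).

Definition sav_step (n : nat) : Prop :=
  [/\ square_integrable Omega (dissipation_field n),
      (r n.+1 - r n) / dt
        = - gamma * xi n.+1 * L2norm Omega (dissipation_field n) ^+ 2 &
      xi n.+1 = r n.+1 / (energy Omega (mt n.+1%:Z) + K0)].

Definition projection_step (n : nat) : Prop :=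
  forall x, Omega x ->
    [/\ mh n.+1 x = eta_coef l (xi n.+1) *: mt n.+1%:Z x
                    + const_mx ((eta_coef l (xi n.+1) - 1) ^+ w),
        mh n.+1 x != 0 &
        m n.+1%:Z x = (enorm (mh n.+1 x))^-1 *: mh n.+1 x].

(* The order-l scheme acts at the steps l-1 <= n < N. The fields m^j and \tilde m^j
   with j <= l-1 are starting data; m^j with 1-l <= j < 0 only serves to give a
   meaning to B_l(m^k) for k < l-1, and by varying these fields B_l(m^k) can be
   any extrapolated field used in the starting steps. *)
Record imex_gsav : Prop := ImexGsav {
  admissible_m : forall j : int, 1 - l%:Z <= j <= N%:Z -> admissible bc Omega (m j);
  admissible_mt : forall j : int, 0 <= j <= N%:Z -> admissible bc Omega (mt j);
  initial_m : m 0 = m0;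
  initial_r : r 0%N = energy Omega m0 + K0;
  field_steps : forall n : nat, (l.-1 <= n < N)%N ->
    semi_implicit_step n /\ projection_step n;
  sav_steps : forall n : nat, (n < N)%N -> sav_step n }.

End Scheme.

(* Main.v *)
Require Import Defs.
From HB Require Import structures.
From mathcomp Require Import all_boot all_order all_algebra.
From mathcomp Require Import all_classical all_reals all_analysis.
From mathcomp Require Import ring lra.

Set Implicit Arguments.
Unset Strict Implicit.
Unset Printing Implicit Defensive.

Import Order.TTheory GRing.Theory Num.Theory.
Import numFieldNormedType.Exports.

Local Open Scope classical_set_scope.
Local Open Scope ring_scope.

(** The scalar equation is linear in the new value: writing [e] for the shifted
energy [E(mt^{n+1}) + K0 >= K0 > 0] and [D] for the norm of the dissipation
field, it says [R^{n+1} (1 + dt gamma D^2 / e) = R^n].  Hence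
[0 < R^{n+1} <= R^n], strictly as soon as [D > 0], and [xi^{n+1} = R^{n+1} / e]
is positive (sav_recursion).  By induction [0 < R^n <= A := E(m_0) + K0] for
all [n], a bound that does not see the time step (sav_range).

Both terms to be estimated follow from this.  The dissipation sum telescopes to
[R^0 - R^{n+1} <= A] (dissipation_sum_le).  For the gradient, [mh^{n+1}] is
[eta mt^{n+1}] plus a constant on the open set [Omega], so its gradient has
norm [|eta| * G] with [G] the norm of the gradient of [mt^{n+1}]
(grad_norm_mh).  There is no a priori bound on [G], but [eta] vanishes with
[xi]: since [1 - (1 - xi)^p] is divisible by [xi] and [xi <= A / K0], one has
[|eta| <= C xi] (eta_coef_bound); and [xi G = R^{n+1} G / (G^2 / 2 + K0)] is
bounded, because the energy in the denominator is quadratic in [G]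
(sav_ratio_bound, eta_gradient_bound).

The differential operators and the integrals are total functions, so the
identity for the gradient norm rests on two general facts: the differential at
a point only depends on the values near that point (near_eq_diff), and a
positive factor can be taken out of the integral of any nonnegative function
(integralZl_posr). *)

(** * Scaling of integrals and of the L2 norm *)

Section IntegralScaling.
Context {dd : measure_display} {T : measurableType dd} {R : realType}.
Variable mu : {measure set T -> \bar R}.
Implicit Types (D : set T) (f : T -> \bar R) (k : R).
Local Open Scope ereal_scope.

Import HBNNSimple.

(** The integral of a nonnegative function is the supremum of the integrals of
the simple functions below it, and dividing by [k] sends the simple functions
below [k f] to simple functions below [f].  Arguing on the supremum, instead of
by monotone convergence, covers every [f], measurable or not. *)
Lemma le_integralZl_posr D f k : (0 < k)%R -> (forall x, D x -> 0 <= f x) ->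
  \int[mu]_(x in D) (k%:E * f x) <= k%:E * \int[mu]_(x in D) f x.
Proof.
move=> k0 f0; have kV0 : (0 <= k^-1)%R by rewrite invr_ge0 ltW.
have kf0 x : D x -> 0 <= k%:E * f x.
  by move=> Dx; rewrite mule_ge0 ?lee_fin ?(ltW k0) ?f0.
rewrite ge0_integralE// ge0_integralE//.
apply/ge_ereal_sup => _ [h /= hf <-].
rewrite -lee_pdivrMl// -sintegralrM.
apply: ereal_sup_ubound; exists (scale_nnsfun h kV0) => // x.
have := hf x; rewrite /patch /=; case: ifPn => _ hx.
  by rewrite EFinM lee_pdivrMl.
by rewrite lee_fin mulr_ge0_le0// -lee_fin.
Qed.

(** The reverse inequality is the previous one for the factor [k^-1] applied to
the function [k f]. *)
Lemma integralZl_posr D f k : (0 < k)%R -> (forall x, D x -> 0 <= f x) ->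
  \int[mu]_(x in D) (k%:E * f x) = k%:E * \int[mu]_(x in D) f x.
Proof.
move=> k0 f0; apply/eqP; rewrite eq_le le_integralZl_posr//=.
have kV0 : (0 < k^-1)%R by rewrite invr_gt0.
rewrite -lee_pdivlMl//; apply: le_trans (le_integralZl_posr kV0 _); last first.
  by move=> x Dx; rewrite mule_ge0 ?lee_fin ?(ltW k0) ?f0.
rewrite le_eqVlt; apply/orP; left; apply/eqP/eq_integral => x _.
by rewrite muleA -EFinM mulVf ?mul1e// gt_eqF.
Qed.

End IntegralScaling.

Section L2norm.
Context {R : realType} {d p q : nat}.
Implicit Types (Omega : set 'rV[R]_d) (f g : 'rV[R]_d -> 'M[R]_(p, q)).

Lemma enormZ_sqr (k : R) (A : 'M[R]_(p, q)) :
  enorm (k *: A) ^+ 2 = k ^+ 2 * enorm A ^+ 2.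
Proof.
rewrite /enorm !sqr_sqrtr; try by do 2![apply: sumr_ge0 => ? _]; exact: sqr_ge0.
rewrite mulr_sumr; apply: eq_bigr => i _; rewrite mulr_sumr.
by apply: eq_bigr => j _; rewrite mxE exprMn.
Qed.

Lemma L2norm_ge0 Omega f : 0 <= L2norm Omega f.
Proof. exact: sqrtr_ge0. Qed.

(** The real-valued integral is 0 when the extended one is infinite; multiplying
by [k] preserves this convention, so the identity holds for every [f]. *)
Lemma L2normZ Omega f g k : (forall x, Omega x -> g x = k *: f x) ->
  L2norm Omega g = `|k| * L2norm Omega f.
Proof.
move=> gf; rewrite /L2norm -sqrtr_sqr -sqrtrM ?sqr_ge0//; congr Num.sqrt.
rewrite /Rintegral.
under eq_integral => t /set_mem /= Ot do rewrite gf// enormZ_sqr EFinM.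
have [->|k0] := eqVneq k 0.
  rewrite integral0_eq => [|t _]; first by rewrite expr0n mul0r.
  by rewrite expr0n mul0e.
have k2 : 0 < k ^+ 2 by rewrite exprn_even_gt0.
rewrite integralZl_posr// => [|t _]; last by rewrite lee_fin sqr_ge0.
have := @integral_ge0 _ _ R (@lebesgue_tuple R d)
  (@row_of_tuple R d @^-1` Omega)
  (fun t => (enorm (f (row_of_tuple t)) ^+ 2)%:E) _.
move=> /(_ (fun t _ => sqr_ge0 _)).
by case: (integral _ _ _) => [r _//|_|//]; rewrite gt0_muley ?lte_fin//= mulr0.
Qed.

End L2norm.

(** * Locality of the differential *)

Section LocalDifferential.
Context {R : realType}.

(** The differential of [f] satisfies the first-order expansion of [g], because
that expansion only involves values near [x]; uniqueness concludes. *)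
Lemma near_eq_diff (V W : normedModType R) (f g : V -> W) (x : V) :
  (\forall y \near x, g y = f y) -> differentiable f x -> 'd g x = 'd f x :> (V -> W).
Proof.
move=> gf df; apply: diff_unique; first exact: diff_continuous.
apply/eqaddoP => e e0.
have /eqaddoP/(_ e e0) := diff_locally df.
have gf0 : \forall h \near 0, g (h + x) = f (h + x).
  have := gf; rewrite (near_shift 0 x).
  by apply: filterS => h /=; rewrite subr0.
apply: filterS2 gf0 => h /= gfh.
by rewrite /= !fctE /= gfh (nbhs_singleton gf).
Qed.

Lemma near_eq_diffZD (V W : normedModType R) (u v : V -> W) (a : R) (c : W)
    (x : V) : (\forall y \near x, v y = a *: u y + c) -> differentiable u x ->
  'd v x = a \*: 'd u x :> (V -> W).
Proof.
move=> vu /differentiableP du.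
have D : is_diff x (a *: u + cst c) (a *: ('d u x : V -> W) + 0).
  exact: is_diffD.
have vu' : \forall y \near x, v y = (a *: u + cst c) y by exact: vu.
apply: eq_trans (near_eq_diff vu' (@ex_diff _ _ _ _ _ _ _ D)) _.
apply: eq_trans (@diff_val _ _ _ _ _ _ _ D) _.
by rewrite addr0.
Qed.

Lemma near_eq_jacobianZD (d q : nat) (u v : 'rV[R]_d -> 'rV[R]_q)
    (a : R) (c : 'rV[R]_q) (x : 'rV[R]_d) :
  (\forall y \near x, v y = a *: u y + c) -> differentiable u x ->
  'J v x = a *: 'J u x.
Proof.
move=> vu du; have /funeqP dE := near_eq_diffZD vu du.
apply/matrixP => i j; rewrite mxE [in RHS]mxE.
rewrite [in RHS]mxE.
rewrite [LHS](congr1 (fun z : 'rV[R]_q => z 0 j) (dE _)).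
by rewrite [LHS]mxE.
Qed.

End LocalDifferential.

(** * Scalar estimates for the auxiliary variable *)

Section SavBounds.
Context {R : realType}.

(** The two cases in the definition of [eta_coef] are one formula: the exponent
is 2 for order 1 and the order itself from order 2 on. *)
Lemma eta_coefE (l : nat) (xi : R) : (0 < l)%N ->
  eta_coef l xi = 1 - (1 - xi) ^+ maxn 2 l.
Proof.
rewrite /eta_coef; case: l => [//|[//|l]] _ /=.
by rewrite (maxn_idPr _).
Qed.

(** The polynomial [1 - (1 - xi)^p] is [xi] times the sum of the [p] powers
[(1 - xi)^i], [i < p], each of which is at most [(1 + C)^p] on [[0, C]]. *)
Lemma eta_coef_bound (l : nat) (xi C : R) : (0 < l)%N -> 0 <= xi <= C ->
  `|eta_coef l xi| <= (maxn 2 l)%:R * (1 + C) ^+ maxn 2 l * xi.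
Proof.
move=> l0 /andP[xi0 xiC]; rewrite eta_coefE//; move: (maxn 2 l) => p.
rewrite distrC subrX1 normrM addrAC subrr add0r normrN (ger0_norm xi0).
rewrite [leRHS]mulrC ler_wpM2l// (le_trans (ler_norm_sum _ _ _))//.
rewrite mulr_natl -[X in _ <= _ *+ X](card_ord p) -sumr_const ler_sum// => i _.
have C1 : 1 <= 1 + C by rewrite lerDl (le_trans xi0).
rewrite normrX (le_trans _ (ler_weXn2l C1 (ltnW (ltn_ord i))))//.
rewrite lerXn2r ?nnegrE ?(le_trans ler01 C1)//.
by rewrite (le_trans (ler_normB _ _))// normr1 ger0_norm// lerD2l.
Qed.

(** For [x] the norm of a gradient, the denominator is the shifted energy.  The
right-hand side comes from [x <= x^2 / 2 + 1 / 2]: the product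
[(1 + 1 / K0) (x^2 / 2 + K0)] is at least [x^2 / 2 + 1]. *)
Lemma sav_ratio_bound (K0 x : R) : 0 < K0 ->
  x / (2^-1 * x ^+ 2 + K0) <= 1 + K0^-1.
Proof.
move=> K00.
have KV0 : 0 < K0^-1 by rewrite invr_gt0.
have KKV : K0 * K0^-1 = 1 by rewrite divff ?gt_eqF.
have x2 : 0 <= x ^+ 2 by exact: sqr_ge0.
have KVx2 : 0 <= K0^-1 * x ^+ 2 by rewrite mulr_ge0// ltW.
rewrite ler_pdivrMr; last by lra.
have := sqr_ge0 (x - 1); nra.
Qed.

(** No bound on [g] alone is available: the factor [xi] in the bound of
[eta_coef] supplies the decay in [g] that makes the product bounded. *)
Lemma eta_gradient_bound (l : nat) (K0 A r1 g xi : R) :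
  (0 < l)%N -> 0 < K0 -> 0 < r1 <= A -> 0 <= g ->
  xi = r1 / (2^-1 * g ^+ 2 + K0) ->
  `|eta_coef l xi| * g <=
  (maxn 2 l)%:R * (1 + A / K0) ^+ maxn 2 l * (A * (1 + K0^-1)).
Proof.
move=> l0 K00 /andP[r10 r1A] g0; set e := 2^-1 * g ^+ 2 + K0 => xiE.
have eK : K0 <= e by rewrite lerDr mulr_ge0 ?invr_ge0 ?sqr_ge0.
have e0 : 0 < e by exact: lt_le_trans eK.
have A0 : 0 < A by exact: lt_le_trans r1A.
have xi_range : 0 <= xi <= A / K0.
  rewrite xiE divr_ge0 ?(ltW r10) ?(ltW e0)//=.
  (* r1 <= A in the numerator, e >= K0 in the denominator *)
  by rewrite ler_pM ?invr_ge0 ?(ltW r10) ?(ltW e0)// lef_pV2 ?posrE.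
have xig : xi * g <= A * (1 + K0^-1).
  rewrite xiE mulrAC -mulrA ler_pM ?(ltW r10)//; last exact: sav_ratio_bound.
  by rewrite divr_ge0 ?(ltW e0).
rewrite (le_trans (ler_wpM2r g0 (eta_coef_bound l0 xi_range)))//.
rewrite -[leLHS]mulrA; apply: ler_wpM2l xig.
rewrite mulr_ge0// exprn_ge0// addr_ge0//.
by rewrite divr_ge0 ?ltW.
Qed.

(** Eliminating [xi1] gives [r1 (1 + dt c D^2 / e) = r0] with a factor at least
1, and larger than 1 when [D > 0]. *)
Lemma sav_recursion (dt c D e r0 r1 xi1 : R) :
  0 < dt -> 0 < c -> 0 < e -> 0 < r0 ->
  (r1 - r0) / dt = - c * xi1 * D ^+ 2 -> xi1 = r1 / e ->
  [/\ 0 < xi1, 0 < r1, r1 <= r0 & 0 < D -> r1 < r0].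
Proof.
move=> dt0 c0 e0 r00 E xiE.
have drop : r1 - r0 = - (dt * c * D ^+ 2 / e) * r1.
  by rewrite -[LHS](divfK (lt0r_neq0 dt0)) E xiE; ring.
have q0 : 0 <= dt * c * D ^+ 2 / e.
  by rewrite divr_ge0 ?(ltW e0)// mulr_ge0 ?sqr_ge0// ltW// mulr_gt0.
have r10 : 0 < r1 by nra.
split => //; [by rewrite xiE divr_gt0|by nra|move=> D0].
have : 0 < dt * c * D ^+ 2 / e by rewrite divr_gt0// !mulr_gt0// exprn_gt0.
nra.
Qed.

End SavBounds.

(** * Bounds for the scheme *)

Section SchemeBounds.
Context {R : realType} {d : nat}.
Local Notation field := ('rV[R]_d -> 'rV[R]_3).
Variables (Omega : set 'rV[R]_d) (bc : boundary_condition R d).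
Variables (gamma beta S K0 : R) (l w N : nat) (dt : R) (m0 : field).
Variables (m mt : int -> field) (mh : nat -> field) (r xi : nat -> R).
Hypotheses (Omega_open : open Omega) (gamma0 : 0 < gamma) (K00 : 0 < K0).
Hypotheses (l0 : (0 < l)%N) (dt0 : 0 < dt).
Hypothesis scheme : imex_gsav Omega bc gamma beta S K0 l w N dt m0 m mt mh r xi.

Local Notation A := (energy Omega m0 + K0).
Local Notation D n := (L2norm Omega (dissipation_field l m mt n)).
Local Notation G n := (L2norm Omega (grad (mt n.+1%:Z))).

Lemma shifted_energy_gt0 (u : field) : 0 < energy Omega u + K0.
Proof. by rewrite ltr_wpDl// mulr_ge0 ?invr_ge0 ?sqr_ge0. Qed.

Lemma sav_monotone n : (n < N)%N -> 0 < r n ->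
  [/\ 0 < xi n.+1, 0 < r n.+1, r n.+1 <= r n & 0 < D n -> r n.+1 < r n].
Proof.
move=> nN rn0; have [_ rE xiE] := sav_steps scheme nN.
exact: sav_recursion dt0 gamma0 (shifted_energy_gt0 _) rn0 rE xiE.
Qed.

(** The bound is the initial value, whatever the number of steps: this is where
the uniformity of the final constant in the time step comes from. *)
Lemma sav_range n : (n <= N)%N -> 0 < r n <= A.
Proof.
elim: n => [_|n IH nN]; first by rewrite (initial_r scheme) shifted_energy_gt0/=.
have /andP[rn0 rnA] := IH (ltnW nN).
have [_ -> rn1 _] := sav_monotone nN rn0.
exact: le_trans rn1 rnA.
Qed.

(** Each summand is the decrease [r k - r k.+1], so the sum telescopes. *)
Lemma dissipation_sum_le n : (n < N)%N ->
  \sum_(0 <= k < n.+1) dt * gamma * xi k.+1 * D k ^+ 2 <= A.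
Proof.
move=> nN; rewrite (@telescope_sumr_eq _ 0 n.+1 (fun k => - r k))//.
  rewrite opprK addrC (initial_r scheme) gerBl.
  by have /andP[/ltW] := sav_range nN.
move=> k /andP[_ kn].
have [_ rE _] := sav_steps scheme (leq_trans kn nN).
have : r k.+1 - r k = - (dt * gamma * xi k.+1 * D k ^+ 2).
  by rewrite -[LHS](divfK (lt0r_neq0 dt0)) rE; ring.
by move=> /eqP; rewrite -eqr_oppLR opprB => /eqP <-; rewrite addrC opprK.
Qed.

Lemma mt_differentiable n x : (n <= N)%N -> Omega x ->
  differentiable (mt n%:Z) x.
Proof.
move=> nN Ox.
have [+ _] : admissible bc Omega (mt n%:Z) by apply: (admissible_mt scheme).
by case: bc => [[C2 _]|P [C2 _]]; have [] := C2 x _.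
Qed.

(** The step defines [mh] on [Omega] only; as [Omega] is open this determines
the gradient there, and the constant shift [(eta - 1)^w] drops out of it. *)
Lemma grad_norm_mh n : (l.-1 <= n < N)%N ->
  L2norm Omega (grad (mh n.+1)) = `|eta_coef l (xi n.+1)| * G n.
Proof.
move=> /andP[ln nN]; apply: L2normZ => x Ox.
have [_ proj] := field_steps scheme (introT andP (conj ln nN)).
apply: near_eq_jacobianZD (mt_differentiable nN Ox).
have := open_nbhs_nbhs (conj Omega_open Ox).
by apply: filterS => y Oy; have [->] := proj y Oy.
Qed.

Lemma grad_norm_mh_le n : (l.-1 <= n < N)%N ->
  L2norm Omega (grad (mh n.+1)) <=
  (maxn 2 l)%:R * (1 + A / K0) ^+ maxn 2 l * (A * (1 + K0^-1)).
Proof.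
move=> ln; have /andP[_ nN] := ln.
have [_ _ xiE] := sav_steps scheme nN.
rewrite grad_norm_mh//.
exact: eta_gradient_bound l0 K00 (sav_range nN) (L2norm_ge0 _ _) xiE.
Qed.

End SchemeBounds.

Theorem theorem3p1 (R : realType) (d : nat) (hd : (1 <= d <= 3)%N)
  (Omega : set 'rV[R]_d) (Omega_open : open Omega)
  (Omega_connected : connected Omega) (Omega_nonempty : Omega !=set0)
  (Omega_bounded : bounded_set Omega)
  (bc : boundary_condition R d) (hbc : bc_domain bc Omega)
  (T gamma beta S K0 : R) (hT : 0 < T) (hgamma : 0 < gamma)
  (hS : 0 <= S) (hK0 : 0 < K0)
  (l w : nat) (hl : (1 <= l)%N) (hw : (0 < w)%N)
  (m0 : 'rV[R]_d -> 'rV[R]_3) (hm0 : forall x, Omega x -> enorm (m0 x) = 1) :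
  (forall (N : nat) (m mt : int -> 'rV[R]_d -> 'rV[R]_3)
      (mh : nat -> 'rV[R]_d -> 'rV[R]_3) (r xi : nat -> R),
    (0 < N)%N ->
    imex_gsav Omega bc gamma beta S K0 l w N (T / N%:R) m0 m mt mh r xi ->
    forall n : nat, (n < N)%N -> 0 < r n ->
      [/\ 0 < xi n.+1, 0 < r n.+1, r n.+1 <= r n &
          0 < L2norm Omega (dissipation_field l m mt n) -> r n.+1 < r n])
  /\
  (exists MT : R,
    forall (N : nat) (m mt : int -> 'rV[R]_d -> 'rV[R]_3)
      (mh : nat -> 'rV[R]_d -> 'rV[R]_3) (r xi : nat -> R),
    (0 < N)%N ->
    imex_gsav Omega bc gamma beta S K0 l w N (T / N%:R) m0 m mt mh r xi ->
    forall n : nat, (l.-1 <= n < N)%N ->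
      L2norm Omega (grad (mh n.+1))
      + \sum_(0 <= k < n.+1)
          (T / N%:R) * gamma * xi k.+1 * L2norm Omega (dissipation_field l m mt k) ^+ 2
      <= MT).
Proof.
split=> [N m mt mh r xi N0 scheme n nN rn0|].
  have dt0 : 0 < T / N%:R by rewrite divr_gt0 ?ltr0n.
  exact: (sav_monotone hgamma hK0 dt0 scheme).
eexists => N m mt mh r xi N0 scheme n ln.
have dt0 : 0 < T / N%:R by rewrite divr_gt0 ?ltr0n.
have /andP[_ nN] := ln.
apply: lerD.
  exact: (grad_norm_mh_le Omega_open hgamma hK0 hl dt0 scheme).
exact: (dissipation_sum_le hgamma hK0 dt0 scheme).
Qed.
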